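(* Let $I\subseteq\mathbb R$ be an open interval and let $\mathbf A:I\to\mathbb H^{n\times n}$ be continuous. (1) Let $\mathbf b:I\to\mathbb H^{n\times1}$ be continuous, let $\mathbf X_r$ be a fundamental matrix of $\mathbf x'=\mathbf A(t)\mathbf x$, and let $\mathbf u^{NH}$ be an arbitrary (column) solution of $\mathbf x'=\mathbf A(t)\mathbf x+\mathbf b(t)$ on $I$. Then any solution $\mathbf x^{NH}$ of $\mathbf x'=\mathbf A(t)\mathbf x+\mathbf b(t)$ on $I$ can be expressed as $$\mathbf x^{NH}(t)=\mathbf X_r(t)\mathbf q+\mathbf u^{NH}(t),$$ where $\mathbf q\in\mathbb H^{n\times1}$ is a constant column vector. (2) Let $\mathbf b:I\to\mathbb H^{1\times n}$ be continuous, let $\mathbf X_l$ be a fundamental matrix of $\mathbf x'=\mathbf x\mathbf A(t)$, and let $\mathbf u^{NH}$ be an arbitrary (row) solution of $\mathbf x'=\mathbf x\mathbf A(t)+\mathbf b(t)$ on $I$. Then any solution $\mathbf x^{NH}$ of $\mathbf x'=\mathbf x\mathbf A(t)+\mathbf b(t)$ on $I$ can be expressed as $$\mathbf x^{NH}(t)=\mathbf q\,\mathbf X_l(t)+\mathbf u^{NH}(t),$$ where $\mathbf q\in\mathbb H^{1\times n}$ is a constant row vector.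
   Context: $\mathbb H$ is the real quaternion skew field; derivatives with respect to the real variable $t$ are componentwise. A fundamental matrix $\mathbf X_r(t)=[\mathbf x_1(t),\dots,\mathbf x_n(t)]$ of $\mathbf x'=\mathbf A(t)\mathbf x$ is a matrix whose columns are solutions of this system that are right linearly independent on $I$ (no constants $q_1,\dots,q_n\in\mathbb H$, not all zero, satisfy $\sum_i\mathbf x_i(t)q_i=\mathbf 0$ for all $t\in I$). A fundamental matrix $\mathbf X_l(t)$ of $\mathbf x'=\mathbf x\mathbf A(t)$ is a matrix whose rows $\mathbf x_1(t),\dots,\mathbf x_n(t)$ are solutions of this system that are left linearly independent on $I$ (no constants $q_1,\dots,q_n\in\mathbb H$, not all zero, satisfy $\sum_iq_i\mathbf x_i(t)=\mathbf 0$ for all $t\in I$). *)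

(* Defs.v *)
From HB Require Import structures.
From mathcomp Require Import all_boot all_order all_algebra.
From mathcomp Require Import all_classical all_reals all_analysis.
From mathcomp Require Import ring lra.
Set Implicit Arguments.
Unset Strict Implicit.
Unset Printing Implicit Defensive.
Import Order.TTheory GRing.Theory Num.Theory.
Import numFieldNormedType.Exports.
Local Open Scope classical_set_scope.
Local Open Scope ring_scope.

(* (a, b, c, d) stands for a + b i + c j + d k; addition and topology are those
   of R^4, but the product is Hamilton's, not the componentwise one. *)
Definition quat (R : realType) : Type := (R * R * R * R)%type.

Section Quaternion.
Variable R : realType.
Implicit Types q : quat R.

HB.instance Definition _ := GRing.Zmodule.copy (quat R) (R * R * R * R)%type.
HB.instance Definition _ :=
  Uniform.copy (quat R) (R * R * R * R)%type.

Definition qre q : R := q.1.1.1.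
Definition qi q : R := q.1.1.2.
Definition qj q : R := q.1.2.
Definition qk q : R := q.2.

Definition qone : quat R := (1, 0, 0, 0).

Definition qmul p q : quat R :=
  (qre p * qre q - qi p * qi q - qj p * qj q - qk p * qk q,
   qre p * qi q + qi p * qre q + qj p * qk q - qk p * qj q,
   qre p * qj q - qi p * qk q + qj p * qre q + qk p * qi q,
   qre p * qk q + qi p * qj q - qj p * qi q + qk p * qre q).

Definition qnorm2 q : R := qre q ^+ 2 + qi q ^+ 2 + qj q ^+ 2 + qk q ^+ 2.

Definition qinv q : quat R :=
  (qre q / qnorm2 q, - qi q / qnorm2 q, - qj q / qnorm2 q, - qk q / qnorm2 q).

Fact qext p q : qre p = qre q -> qi p = qi q -> qj p = qj q -> qk p = qk q ->
  p = q.
Proof.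
by case: p q => [[[? ?] ?] ?] [[[? ?] ?] ?]; rewrite /qre /qi /qj /qk /=
  => -> -> -> ->.
Qed.

Fact qmulA : associative qmul.
Proof.
move=> [[[? ?] ?] ?] [[[? ?] ?] ?] [[[? ?] ?] ?].
by rewrite /qmul /qre /qi /qj /qk /=; congr (_, _, _, _); ring.
Qed.

Fact qmul1r : left_id qone qmul.
Proof.
move=> [[[? ?] ?] ?].
by rewrite /qmul /qre /qi /qj /qk /=; congr (_, _, _, _); ring.
Qed.

Fact qmulr1 : right_id qone qmul.
Proof.
move=> [[[? ?] ?] ?].
by rewrite /qmul /qre /qi /qj /qk /=; congr (_, _, _, _); ring.
Qed.

Fact qreD p q : qre (p + q) = qre p + qre q. Proof. by []. Qed.
Fact qiD p q : qi (p + q) = qi p + qi q. Proof. by []. Qed.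
Fact qjD p q : qj (p + q) = qj p + qj q. Proof. by []. Qed.
Fact qkD p q : qk (p + q) = qk p + qk q. Proof. by []. Qed.

Fact qmulDl : left_distributive qmul +%R.
Proof.
move=> p q r; apply: qext;
  rewrite /qmul !(qreD, qiD, qjD, qkD) /qre /qi /qj /qk /=; ring.
Qed.

Fact qmulDr : right_distributive qmul +%R.
Proof.
move=> p q r; apply: qext;
  rewrite /qmul !(qreD, qiD, qjD, qkD) /qre /qi /qj /qk /=; ring.
Qed.

Fact qone_neq0 : qone != 0.
Proof. by apply/eqP => -[] /eqP; rewrite oner_eq0. Qed.

HB.instance Definition _ := GRing.Zmodule_isNzRing.Build (quat R)
  qmulA qmul1r qmulr1 qmulDl qmulDr qone_neq0.

Fact qnorm2_eq0 q : (qnorm2 q == 0) = (q == 0).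
Proof.
case: q => [[[a b] c] d]; rewrite /qnorm2 /qre /qi /qj /qk /=.
rewrite !paddr_eq0 ?addr_ge0 ?sqr_ge0// !sqrf_eq0.
by rewrite -[RHS]/([&& [&& (a == 0) && (b == 0) & c == 0] & d == 0]).
Qed.

Fact qmulVr : {in [pred q | q != 0], left_inverse 1 qinv *%R}.
Proof.
move=> [[[a b] c] d]; rewrite inE -qnorm2_eq0 => q0.
by congr (_, _, _, _); move: q0; rewrite /qinv /qnorm2 /qre /qi /qj /qk /= => q0;
  field.
Qed.

Fact qmulrV : {in [pred q | q != 0], right_inverse 1 qinv *%R}.
Proof.
move=> [[[a b] c] d]; rewrite inE -qnorm2_eq0 => q0.
by congr (_, _, _, _); move: q0; rewrite /qinv /qnorm2 /qre /qi /qj /qk /= => q0;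
  field.
Qed.

Fact qunitP p q : q * p = 1 /\ p * q = 1 -> p != 0.
Proof.
case=> qp _; apply/eqP => p0; move: qp; rewrite p0 mulr0 => /esym/eqP.
by rewrite oner_eq0.
Qed.

Fact qinv_out : {in [predC [pred q | q != 0]], qinv =1 id}.
Proof.
move=> q; rewrite !inE negbK => /eqP ->.
by congr (_, _, _, _); rewrite /qre /qi /qj /qk /= ?oppr0 mul0r.
Qed.

HB.instance Definition _ := GRing.NzRing_hasMulInverse.Build (quat R)
  qmulVr qmulrV qunitP qinv_out.

End Quaternion.

Section LinearSystems.
Variables (R : realType) (n : nat).
Implicit Types (I : set R) (A X : R -> 'M[quat R]_n).

Definition is_qderive (x : R -> quat R) (t : R) (dx : quat R) : Prop :=
  [/\ is_derive t 1 (fun s => qre (x s)) (qre dx),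
      is_derive t 1 (fun s => qi (x s)) (qi dx),
      is_derive t 1 (fun s => qj (x s)) (qj dx) &
      is_derive t 1 (fun s => qk (x s)) (qk dx)].

Definition is_mxderive p m (x : R -> 'M[quat R]_(p, m)) (t : R)
    (dx : 'M[quat R]_(p, m)) : Prop :=
  forall i j, is_qderive (fun s => x s i j) t (dx i j).

Definition col_solution I A (b : R -> 'cV[quat R]_n) (x : R -> 'cV[quat R]_n) :=
  forall t, I t -> is_mxderive x t (A t *m x t + b t).

Definition row_solution I A (b : R -> 'rV[quat R]_n) (x : R -> 'rV[quat R]_n) :=
  forall t, I t -> is_mxderive x t (x t *m A t + b t).

(* The library's scaling *: multiplies by the scalar on the left. *)
Definition rscale p m (x : 'M[quat R]_(p, m)) (q : quat R) : 'M[quat R]_(p, m) :=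
  map_mx (fun a => a * q) x.

Definition right_lin_indep I (x : 'I_n -> R -> 'cV[quat R]_n) : Prop :=
  forall q : 'I_n -> quat R,
    (forall t, I t -> \sum_i rscale (x i t) (q i) = 0) -> forall i, q i = 0.

Definition left_lin_indep I (x : 'I_n -> R -> 'rV[quat R]_n) : Prop :=
  forall q : 'I_n -> quat R,
    (forall t, I t -> \sum_i q i *: x i t = 0) -> forall i, q i = 0.

Definition col_fundamental I A X : Prop :=
  (forall j, col_solution I A (fun=> 0) (fun t => col j (X t))) /\
  right_lin_indep I (fun j t => col j (X t)).

Definition row_fundamental I A X : Prop :=
  (forall i, row_solution I A (fun=> 0) (fun t => row i (X t))) /\
  left_lin_indep I (fun i t => row i (X t)).

End LinearSystems.

(* Main.v *)
Require Import Defs.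
From HB Require Import structures.
From mathcomp Require Import all_boot all_order all_algebra.
From mathcomp Require Import all_classical all_reals all_analysis.
From mathcomp Require Import ring.
Set Implicit Arguments.
Unset Strict Implicit.
Unset Printing Implicit Defensive.
Import Order.TTheory GRing.Theory Num.Theory.
Import numFieldNormedType.Exports.
Local Open Scope classical_set_scope.
Local Open Scope ring_scope.

(** Two solutions of the inhomogeneous system differ by a solution [y] of the
    homogeneous one, so everything reduces to writing [y] as [X q] with a
    constant column [q].

    Pick a point [t0] of the interval.  A homogeneous solution that vanishes at
    [t0] vanishes everywhere ([col_solution_unique]).  Consequently the matrix
    [X t0] has trivial right kernel: if [X t0 *m q = 0], then the solution
    [X q] is identically zero, and right linear independence of the columns
    gives [q = 0].  Over a division ring a square matrix with trivial kernel is
    onto ([square_mx_inj_surj]), so some [q] satisfies [X t0 *m q = y t0], and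
    uniqueness applied to [y - X q] finishes the argument.

    Uniqueness is an energy estimate.  The sum [N] of the squared norms of the
    entries of [y] satisfies [|N'| <= C N] on every segment of the interval,
    because the continuous coefficients are bounded there
    ([continuous_segment_bounded]); weighting [N] by an exponential then forces
    [N = 0] ([gronwall_zero]).

    Row systems need no separate argument: quaternion conjugation reverses
    products, so if [x' = x A] then the conjugate transpose [y] of [x] solves
    the column system [y' = B y], where [B] is the conjugate transpose of [A],
    and left linear independence becomes right linear independence
    ([row_solution_ctmx], [row_fundamental_ctmx]). *)

(** * Linear algebra over a division ring *)

(** Gaussian elimination by induction on the number of equations: solve the
    first equation for one unknown and substitute it into the others.  Over a
    noncommutative ring the scalars acting on unknowns stand on the right, so
    only left multiplications by inverses of coefficients occur. *)
Lemma wide_mx_kernel (D : unitRingType) m n (M : 'M[D]_(m, n)) :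
    (forall x : D, x != 0 -> x \is a GRing.unit) -> (m < n)%N ->
  exists2 q : 'cV[D]_n, q != 0 & M *m q = 0.
Proof.
move=> unitD; elim: m n M => [|m IHm] [//|n] M lt_mn.
  exists (const_mx 1).
    by apply/eqP => /matrixP/(_ 0 0)/eqP; rewrite !mxE oner_eq0.
  by apply/matrixP => -[].
(* If row 0 vanishes any [j] will do; otherwise [M 0 j] is invertible. *)
have [j Mj] : exists j, forall l, M 0 l = M 0 j * ((M 0 j)^-1 * M 0 l).
  have [/existsP[j Mj0]|/existsPn M0] := boolP [exists j, M 0 j != 0].
    by exists j => l; rewrite mulVKr ?unitD.
  by exists 0 => l; move: (M0 0) (M0 l) => /negPn/eqP-> /negPn/eqP->; rewrite mul0r.
(* The columns of [P] parametrize the right kernel of row 0 by the coordinates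
   of index other than [j]. *)
pose P : 'M[D]_(n.+1, n) := \matrix_(k, l)
  if unlift j k is Some k' then (k' == l)%:R
  else - ((M 0 j)^-1 * M 0 (lift j l)).
have [q q0 Mq] := IHm n (row' 0 M *m P) lt_mn.
have Pq k : (P *m q) (lift j k) 0 = q k 0.
  rewrite mxE (bigD1 k)//= !mxE liftK eqxx mul1r big1 ?addr0// => l lk.
  by rewrite mxE liftK eq_sym (negPf lk) mul0r.
exists (P *m q).
  apply: contra_neq q0 => Pq0; apply/colP => k.
  by rewrite -Pq Pq0 !mxE.
have PM0 : row 0 M *m P = 0.
  apply/rowP => l; rewrite mxE (bigD1_ord j)//= !mxE unlift_none mulrN -Mj.
  rewrite (bigD1 l)//= !mxE liftK eqxx mulr1 big1 ?addr0 ?addNr// => k kl.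
  by rewrite !mxE liftK (negPf kl) mulr0.
apply/row_matrixP => i; rewrite [RHS]row0 row_mul mulmxA.
have [->|] := eqVneq i 0; first by rewrite PM0 mul0mx.
rewrite eq_sym => /unlift_some [k -> _].
have -> : row (lift 0 k) M = row k (row' 0 M).
  by apply/rowP => l; rewrite !mxE.
by rewrite -!row_mul Mq [LHS]row0.
Qed.

(** The wide matrix [row_mx M (- y)] has a nonzero kernel vector; injectivity
    of [M] forces its last coordinate to be nonzero, and dividing by that
    coordinate on the right solves [M *m q = y]. *)
Lemma square_mx_inj_surj (D : unitRingType) n (M : 'M[D]_n) :
    (forall x : D, x != 0 -> x \is a GRing.unit) ->
    (forall q : 'cV_n, M *m q = 0 -> q = 0) ->
  forall y : 'cV_n, exists q, M *m q = y.
Proof.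
move=> unitD injM y.
have [|v v0] := @wide_mx_kernel D n (n + 1) (row_mx M (- y)) unitD.
  by rewrite addn1.
rewrite -[v]vsubmxK mul_row_col mulNmx => /eqP.
rewrite subr_eq0 => /eqP Mvy.
set c := dsubmx v 0 0.
have c0 : c != 0.
  apply: contra_neq v0 => c0.
  have d0 : dsubmx v = 0 by apply/colP => k; rewrite ord1 [RHS]mxE.
  move: Mvy; rewrite d0 mulmx0 => /injM u0.
  by rewrite -[v]vsubmxK u0 d0 col_mx0.
exists (usubmx v *m (c^-1)%:M).
rewrite mulmxA Mvy; apply/colP => k.
by rewrite mxE big_ord1 !mxE eqxx mulr1n big_ord1 -/c mulrK ?unitD.
Qed.

(** * Quaternions *)

Section Quaternions.
Variable R : realType.
Implicit Types p q : quat R.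

Lemma qnorm2_ge0 q : 0 <= qnorm2 q.
Proof. by rewrite !addr_ge0 ?sqr_ge0. Qed.

Lemma qnorm2M p q : qnorm2 (p * q) = qnorm2 p * qnorm2 q.
Proof. by rewrite /qnorm2/qre/qi/qj/qk/= /qre/qi/qj/qk/=; ring. Qed.

Lemma quat_unit q : q != 0 -> q \is a GRing.unit.
Proof. by []. Qed.

Definition qconj q : quat R := (qre q, - qi q, - qj q, - qk q).

Lemma qconjB : {morph qconj : p q / p - q}.
Proof. by move=> p q; apply: qext; rewrite // /qi/qj/qk/= opprD. Qed.

HB.instance Definition _ :=
  GRing.isZmodMorphism.Build (quat R) (quat R) qconj qconjB.

Lemma qconjM p q : qconj (p * q) = qconj q * qconj p.
Proof. by apply: qext; rewrite /qre/qi/qj/qk/= /qre/qi/qj/qk/=; ring. Qed.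

Lemma qconjK : involutive qconj.
Proof. by move=> q; apply: qext; rewrite // /qi/qj/qk/= opprK. Qed.

Lemma qnorm2_conj q : qnorm2 (qconj q) = qnorm2 q.
Proof. by rewrite /qnorm2/qre/qi/qj/qk/= !sqrrN. Qed.

(** The Euclidean inner product of R^4. *)
Definition qdot p q : R :=
  qre p * qre q + qi p * qi q + qj p * qj q + qk p * qk q.

Lemma qdot_sumr n p (q : 'I_n -> quat R) : qdot p (\sum_i q i) = \sum_i qdot p (q i).
Proof.
apply: (big_morph (qdot p)) => [a b|]; last by rewrite /qdot !mulr0 !addr0.
by rewrite /qdot /qre /qi /qj /qk /=; ring.
Qed.

(** The inequality of arithmetic and geometric means, read off from the
    nonnegativity of the squared norms of [p + a q] and [p - a q]. *)
Lemma qdot_mulr_le p a q : `|qdot p (a * q)| *+ 2 <= qnorm2 p + qnorm2 a * qnorm2 q.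
Proof.
rewrite -qnorm2M -normrMn ler_norml; move: (a * q) => {a}q; apply/andP; split.
  rewrite lerNl -subr_ge0.
  have -> : qnorm2 p + qnorm2 q - - (qdot p q *+ 2) = qnorm2 (p + q).
    by rewrite /qdot /qnorm2 /qre /qi /qj /qk /=; ring.
  exact: qnorm2_ge0.
rewrite -subr_ge0.
have -> : qnorm2 p + qnorm2 q - (qdot p q *+ 2) = qnorm2 (p - q).
  by rewrite /qdot /qnorm2 /qre /qi /qj /qk /=; ring.
exact: qnorm2_ge0.
Qed.

End Quaternions.

(** * Differentiation of quaternion-valued functions *)

Section Differentiation.
Variable R : realType.
Implicit Types (q : quat R) (x y : R -> quat R).

(** Every coordinate of [p * q], for fixed [q], is a real linear form in the
    coordinates of [p].  The coefficients are arguments so that this one lemma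
    differentiates all four coordinates of a product. *)
Lemma is_derive_qlin (c0 c1 c2 c3 : R) (h : quat R -> R) x t dx :
    (forall q, h q = c0 * qre q + c1 * qi q + c2 * qj q + c3 * qk q) ->
  is_qderive x t dx -> is_derive t 1 (h \o x) (h dx).
Proof.
move=> hE [d0 d1 d2 d3].
have -> : h \o x = (c0 \*: (fun s => qre (x s))) + (c1 \*: (fun s => qi (x s)))
    + (c2 \*: (fun s => qj (x s))) + (c3 \*: (fun s => qk (x s))).
  by apply/funext => s; rewrite /= hE.
rewrite hE; do 3?[apply: is_deriveD]; exact: is_deriveZ.
Qed.

Lemma is_qderiveD x y t (dx dy : quat R) :
  is_qderive x t dx -> is_qderive y t dy ->
  is_qderive (fun s => x s + y s) t (dx + dy).
Proof. by move=> [? ? ? ?] [? ? ? ?]; split; exact: is_deriveD. Qed.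

Lemma is_qderiveB x y t (dx dy : quat R) :
  is_qderive x t dx -> is_qderive y t dy ->
  is_qderive (fun s => x s - y s) t (dx - dy).
Proof. by move=> [? ? ? ?] [? ? ? ?]; split; exact: is_deriveB. Qed.

Lemma is_qderive_sum n (x : 'I_n -> R -> quat R) t (dx : 'I_n -> quat R) :
  (forall i, is_qderive (x i) t (dx i)) ->
  is_qderive (fun s => \sum_i x i s) t (\sum_i dx i).
Proof.
elim: n x dx => [|n IHn] x dx dxP.
  under eq_fun do rewrite big_ord0.
  by rewrite big_ord0; split; exact: is_derive_cst.
under eq_fun do rewrite big_ord_recl.
by rewrite big_ord_recl; apply: is_qderiveD => //; exact: IHn.
Qed.

Lemma is_qderiveMr x t dx q :
  is_qderive x t dx -> is_qderive (fun s => x s * q) t (dx * q).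
Proof.
move=> dxP; split.
- apply: (@is_derive_qlin (qre q) (- qi q) (- qj q) (- qk q)
    (fun p : quat R => qre (p * q))) dxP.
  by move=> p; rewrite [LHS]/= /qre/=; ring.
- apply: (@is_derive_qlin (qi q) (qre q) (qk q) (- qj q)
    (fun p : quat R => qi (p * q))) dxP.
  by move=> p; rewrite [LHS]/= /qi/=; ring.
- apply: (@is_derive_qlin (qj q) (- qk q) (qre q) (qi q)
    (fun p : quat R => qj (p * q))) dxP.
  by move=> p; rewrite [LHS]/= /qj/=; ring.
- apply: (@is_derive_qlin (qk q) (qj q) (- qi q) (qre q)
    (fun p : quat R => qk (p * q))) dxP.
  by move=> p; rewrite [LHS]/= /qk/=; ring.
Qed.

Lemma is_qderive_conj x t dx :
  is_qderive x t dx -> is_qderive (@qconj R \o x) t (qconj dx).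
Proof. by move=> [? ? ? ?]; split => //; exact: is_deriveN. Qed.

Lemma is_derive_qnorm2 x t dx : is_qderive x t dx ->
  is_derive t 1 (fun s => qnorm2 (x s)) (qdot (x t) dx *+ 2).
Proof.
move=> [d0 d1 d2 d3].
have -> : (fun s => qnorm2 (x s)) =
    (fun s => qre (x s)) ^+ 2 + (fun s => qi (x s)) ^+ 2
    + (fun s => qj (x s)) ^+ 2 + (fun s => qk (x s)) ^+ 2.
  by apply/funext.
have dotE : qdot (x t) dx *+ 2 =
   (2%:R * qre (x t) ^+ 1) * qre dx + (2%:R * qi (x t) ^+ 1) * qi dx
   + (2%:R * qj (x t) ^+ 1) * qj dx + (2%:R * qk (x t) ^+ 1) * qk dx.
  by rewrite /qdot; ring.
by rewrite dotE; do 3?[apply: is_deriveD]; exact: (is_deriveX 2).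
Qed.

Lemma is_mxderiveB p m (X Y : R -> 'M[quat R]_(p, m)) t dX dY :
  is_mxderive X t dX -> is_mxderive Y t dY ->
  is_mxderive (fun s => X s - Y s) t (dX - dY).
Proof.
move=> dXP dYP i j; under eq_fun do rewrite !mxE.
by rewrite !mxE; exact: is_qderiveB.
Qed.

Lemma is_mxderiveMr p m k (X : R -> 'M[quat R]_(p, m)) t dX
    (q : 'M[quat R]_(m, k)) :
  is_mxderive X t dX -> is_mxderive (fun s => X s *m q) t (dX *m q).
Proof.
move=> dXP i j; under eq_fun do rewrite mxE.
by rewrite mxE; apply: is_qderive_sum => l; exact: is_qderiveMr.
Qed.

End Differentiation.

(** * Continuous coefficients are bounded on segments *)

Lemma mx_entry_continuous (T : topologicalType) m n (i : 'I_m) (j : 'I_n) :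
  continuous (fun M : 'M[T]_(m, n) => M i j).
Proof.
move=> M B MB; exists (fun k l => if (k == i) && (l == j) then B else setT).
  by move=> k l; case: andP => [[/eqP-> /eqP->]//|_]; exact: filterT.
by move=> N /(_ i j); rewrite !eqxx.
Qed.

Lemma fst_continuous (T U : topologicalType) : continuous (@fst T U).
Proof. by move=> x; exact: cvg_fst. Qed.

Lemma snd_continuous (T U : topologicalType) : continuous (@snd T U).
Proof. by move=> x; exact: cvg_snd. Qed.

Section SegmentBounded.
Variable R : realType.

Lemma continuous_qnorm2 : continuous (@qnorm2 R).
Proof.
have c1 : continuous (fun q : quat R => q.1 : R * R * R) by exact: fst_continuous.
have c2 : continuous (fun q : quat R => q.1.1 : R * R).
  by move=> q; exact: (@continuous_comp _ _ _ _ fst q (c1 q) (@fst_continuous _ _ _)).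
have cre : continuous (@qre R).
  by move=> q; exact: (@continuous_comp _ _ _ _ fst q (c2 q) (@fst_continuous _ _ _)).
have ci : continuous (@qi R).
  by move=> q; exact: (@continuous_comp _ _ _ _ snd q (c2 q) (@snd_continuous _ _ _)).
have cj : continuous (@qj R).
  by move=> q; exact: (@continuous_comp _ _ _ _ snd q (c1 q) (@snd_continuous _ _ _)).
have ck : continuous (@qk R) by exact: snd_continuous.
move=> q; rewrite /qnorm2.
have sq (f : quat R -> R) :
    continuous f -> (fun p => f p ^+ 2) x @[x --> q] --> f q ^+ 2.
  move=> cf; apply: (@continuous_comp _ _ _ f (fun x => x ^+ 2) q (cf q)).
  exact: exprn_continuous.
by do 3?[apply: cvgD]; apply: sq.
Qed.

(** The form in which the energy estimate uses continuity of the coefficients.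
    It passes to the conjugate transpose because conjugation preserves norms. *)
Definition segment_bounded (I : set R) m n (A : R -> 'M[quat R]_(m, n)) :=
  forall a b, I a -> I b ->
  exists K, forall t, a <= t <= b -> forall i j, qnorm2 (A t i j) <= K.

Lemma continuous_segment_bounded (I : set R) m n (A : R -> 'M[quat R]_(m, n)) :
  is_interval I -> {within I, continuous A} -> segment_bounded I A.
Proof.
move=> itvI cA a b Ia Ib.
have [ab|ba] := leP a b; last first.
  by exists 0 => t /andP[ta tb]; move: (le_trans ta tb); rewrite leNgt ba.
pose g (M : 'M[quat R]_(m, n)) := \sum_i \sum_j qnorm2 (M i j).
have g_continuous : continuous g.
  apply: continuous_big => [|i _]; first exact: add_continuous.
  apply: continuous_big => [|j _ M]; first exact: add_continuous.
  apply: (continuous_comp (@mx_entry_continuous _ _ _ i j M)).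
  exact: continuous_qnorm2.
have norm_le (M : 'M[quat R]_(m, n)) i j : qnorm2 (M i j) <= g M.
  rewrite /g (bigD1 i)//= (bigD1 j)//= -addrA lerDl addr_ge0// ?sumr_ge0//.
    by move=> *; exact: qnorm2_ge0.
  by move=> k _; apply: sumr_ge0 => *; exact: qnorm2_ge0.
have sub_abI : `[a, b] `<=` I by move=> t; rewrite /= in_itv; exact: itvI.
have [c _ gc] : exists2 c, c \in `[a, b]%R &
    forall t, t \in `[a, b]%R -> (g \o A) t <= (g \o A) c.
  apply: EVT_max => //; apply: within_continuous_comp.
    by move=> M _; exact: g_continuous.
  exact: continuous_subspaceW sub_abI cA.
exists (g (A c)) => t tab i j.
by apply: le_trans (norm_le _ _ _) (gc t _); rewrite in_itv.
Qed.

End SegmentBounded.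

(** * Uniqueness for homogeneous systems *)

Section Uniqueness.
Variable R : realType.
Implicit Types I : set R.

(** Gronwall's inequality with zero initial value, in both time directions:
    the derivative of [N s * exp (c s)] has the sign of [dN s + c * N s], which
    the bound on [dN] controls when [c] is [C] or [- C]. *)
Lemma gronwall_zero I (N dN : R -> R) t0 :
    is_interval I -> I t0 -> N t0 = 0 ->
    (forall t, I t -> 0 <= N t) ->
    (forall t, I t -> is_derive t 1 N (dN t)) ->
    (forall a b, I a -> I b ->
      exists C, forall t, a <= t <= b -> `|dN t| <= C * N t) ->
  forall t, I t -> N t = 0.
Proof.
move=> itvI It0 N0 Nge0 dNP dN_le t It.
apply/eqP; rewrite eq_le Nge0// andbT.
have weighted c s : I s ->
    is_derive s 1 (fun x => N x * expR (c * x))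
      ((dN s + c * N s) * expR (c * s)).
  move=> Is; have dN_s := dNP _ Is.
  have dE : is_derive s 1 (fun x => expR (c * x)) (expR (c * s) * c).
    apply: (@is_derive1_comp _ expR (fun x => c * x)).
    apply: (is_derive_eq (is_deriveZ c (is_derive_id s 1))).
    by rewrite -[_ *: _]/(_ * _) mulr1.
  apply: is_derive_eq (is_deriveM dN_s dE) _.
  by rewrite -[_ *: _]/(_ * _) -[X in _ + X = _]/(_ * _); ring.
have mvt c u v : u <= v -> I u -> I v -> exists2 s, u <= s <= v &
    N v * expR (c * v) - N u * expR (c * u)
      = (dN s + c * N s) * expR (c * s) * (v - u).
  move=> uv Iu Iv.
  have subI s : s \in `[u, v] -> I s by rewrite in_itv /=; exact: itvI.
  have [||s] := @MVT_segment R (fun x => N x * expR (c * x))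
    (fun s => (dN s + c * N s) * expR (c * s)) u v uv.
  - by move=> s /subset_itv_oo_cc/subI/weighted.
  - apply: derivable_within_continuous => s /subI/weighted-/(_ c) [ds _].
    exact: ds.
  by rewrite in_itv => usv eqN; exists s.
(* To the right of [t0] the weight exp(- C s) makes the product nonincreasing,
   to the left exp(C s) makes it nondecreasing; either way it lies below its
   value 0 at [t0]. *)
have [t0t|tt0] := leP t0 t.
  have [C dNC] := dN_le _ _ It0 It.
  have [s /dNC dNs eqN] := mvt (- C) _ _ t0t It0 It.
  have : N t * expR (- C * t) <= 0.
    move: eqN; rewrite N0 mul0r subr0 => ->.
    rewrite mulr_le0_ge0 ?subr_ge0// mulr_le0_ge0 ?expR_ge0//.
    rewrite mulNr subr_le0; exact: le_trans (ler_norm _) dNs.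
  by rewrite pmulr_lle0 ?expR_gt0.
have [C dNC] := dN_le _ _ It It0.
have [s /dNC dNs eqN] := mvt C _ _ (ltW tt0) It It0.
have : 0 <= - (N t * expR (C * t)).
  move: eqN; rewrite N0 mul0r sub0r => ->.
  rewrite mulr_ge0 ?subr_ge0 ?(ltW tt0)// mulr_ge0 ?expR_ge0//.
  rewrite addrC -[dN s]opprK subr_ge0; apply: le_trans dNs.
  by rewrite -normrN ler_norm.
by rewrite oppr_ge0 pmulr_lle0 ?expR_gt0.
Qed.

Lemma col_solutionB n I (A : R -> 'M[quat R]_n) b x u :
  col_solution I A b x -> col_solution I A b u ->
  col_solution I A (fun=> 0) (fun t => x t - u t).
Proof.
move=> xP uP t It; rewrite addr0 mulmxBr.
have -> : A t *m x t - A t *m u t = (A t *m x t + b t) - (A t *m u t + b t).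
  by rewrite opprD addrACA subrr addr0.
by apply: is_mxderiveB; [exact: xP|exact: uP].
Qed.

Lemma col_solutionM n I (A X : R -> 'M[quat R]_n) (q : 'cV_n) :
  (forall j, col_solution I A (fun=> 0) (fun t => col j (X t))) ->
  col_solution I A (fun=> 0) (fun t => X t *m q).
Proof.
move=> XP t It; rewrite addr0 mulmxA; apply: is_mxderiveMr => i j.
have -> : (A t *m X t) i j = (A t *m col j (X t)) i 0.
  by rewrite !mxE; apply: eq_bigr => k _; rewrite mxE.
have := XP j t It i 0; rewrite addr0.
by under eq_fun do rewrite mxE.
Qed.

(** The energy [N], the sum of squared norms of the entries, has derivative
    [2 <y, A y>], which is at most a constant times [N] on every segment. *)
Lemma col_solution_unique n I (A : R -> 'M[quat R]_n) (y : R -> 'cV_n) t0 :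
  is_interval I -> segment_bounded I A -> I t0 ->
  col_solution I A (fun=> 0) y -> y t0 = 0 -> forall t, I t -> y t = 0.
Proof.
move=> itvI bA It0 yP y0.
pose N t := \sum_i qnorm2 (y t i 0).
pose dN t := \sum_i qdot (y t i 0) ((A t *m y t) i 0) *+ 2.
have N_ge0 t : I t -> 0 <= N t.
  by move=> _; apply: sumr_ge0 => i _; exact: qnorm2_ge0.
have dNP t : I t -> is_derive t 1 N (dN t).
  move=> It; have -> : N = \sum_i (fun s => qnorm2 (y s i 0)).
    by apply/funext => s; rewrite fct_sumE.
  apply: is_derive_sum => i; apply: is_derive_qnorm2.
  by have := yP _ It i 0; rewrite addr0.
have N0 : N t0 = 0.
  by rewrite /N big1// => i _; apply/eqP; rewrite y0 mxE qnorm2_eq0.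
have dN_le a b : I a -> I b ->
    exists C, forall t, a <= t <= b -> `|dN t| <= C * N t.
  move=> Ia Ib; have [K AK] := bA _ _ Ia Ib.
  (* If the entries of [A] have squared norm at most [K], summing [qdot_mulr_le]
     over all pairs of indices yields [n * N + n * K * N]. *)
  exists (n%:R * (1 + K)) => t /AK {}AK.
  apply: (le_trans (ler_norm_sum _ _ _)).
  apply: (@le_trans _ _
    (\sum_i \sum_j (qnorm2 (y t i 0) + K * qnorm2 (y t j 0)))).
    apply: ler_sum => i _.
    rewrite mxE qdot_sumr normrMn.
    apply: (@le_trans _ _
      ((\sum_j `|qdot (y t i 0) (A t i j * y t j 0)|) *+ 2)).
      by rewrite lerMn2r /=; exact: ler_norm_sum.
    rewrite -sumrMnl; apply: ler_sum => j _.
    apply: le_trans (qdot_mulr_le _ _ _) _.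
    by rewrite lerD2l ler_wpM2r// qnorm2_ge0.
  under eq_bigr do rewrite big_split /= sumr_const card_ord -mulr_sumr -/(N t).
  rewrite big_split /= sumr_const card_ord sumrMnl -/(N t).
  by rewrite -mulrnDl -[leRHS]mulrA mulrDl mul1r mulr_natl.
move=> t It.
have /eqP := gronwall_zero itvI It0 N0 N_ge0 dNP dN_le It.
rewrite psumr_eq0 => [/allP yt|i _]; last exact: qnorm2_ge0.
apply/colP => i; apply/eqP; rewrite mxE -qnorm2_eq0.
exact: yt (mem_index_enum i).
Qed.

End Uniqueness.

(** * Fundamental matrices span the homogeneous solutions *)

Section Fundamental.
Variable R : realType.
Implicit Types I : set R.

Lemma mulmx_col_sum n (X : 'M[quat R]_n) (q : 'cV_n) :
  X *m q = \sum_j rscale (col j X) (q j 0).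
Proof.
apply/colP => i; rewrite mxE summxE; apply: eq_bigr => j _.
by rewrite !mxE.
Qed.

(** Uniqueness is used twice: evaluation at [t0] turns linear independence of
    functions into injectivity of [X t0], and the solution [y - X q], which
    vanishes at [t0], vanishes everywhere. *)
Lemma col_fundamental_span n I (A X : R -> 'M[quat R]_n) (y : R -> 'cV_n) :
  is_interval I -> segment_bounded I A -> col_fundamental I A X ->
  col_solution I A (fun=> 0) y ->
  exists q : 'cV_n, forall t, I t -> y t = X t *m q.
Proof.
move=> itvI bA [XP Xind] yP.
have [[t0 It0]|I0] := pselect (exists t, I t); last first.
  by exists 0 => t It; case: I0; exists t.
have Xt0_inj (q : 'cV_n) : X t0 *m q = 0 -> q = 0.
  move=> Xq0; apply/colP => i; rewrite mxE.
  apply: (Xind (fun j => q j 0)) => t It; rewrite -mulmx_col_sum.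
  exact: (col_solution_unique itvI bA It0 (col_solutionM q XP)).
have [q Xq] := square_mx_inj_surj (@quat_unit R) Xt0_inj (y t0).
exists q => t It; apply/eqP; rewrite -subr_eq0; apply/eqP.
have yXP := col_solutionB yP (col_solutionM q XP).
by apply: (col_solution_unique itvI bA It0 yXP) It; rewrite Xq subrr.
Qed.

End Fundamental.

(** * Conjugate transposition exchanges row and column systems *)

Section ConjugateTranspose.
Variable R : realType.
Implicit Types I : set R.

Definition ctmx p m (M : 'M[quat R]_(p, m)) : 'M[quat R]_(m, p) :=
  map_mx (@qconj R) M^T.

Lemma ctmxK p m : cancel (@ctmx p m) (@ctmx m p).
Proof. by move=> M; apply/matrixP => i j; rewrite !mxE qconjK. Qed.

Lemma ctmx0 p m : ctmx (0 : 'M[quat R]_(p, m)) = 0.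
Proof. by apply/matrixP => i j; rewrite !mxE raddf0. Qed.

Lemma ctmxD p m (M N : 'M[quat R]_(p, m)) : ctmx (M + N) = ctmx M + ctmx N.
Proof. by apply/matrixP => i j; rewrite !mxE raddfD. Qed.

Lemma ctmxM p m k (M : 'M[quat R]_(p, m)) (N : 'M[quat R]_(m, k)) :
  ctmx (M *m N) = ctmx N *m ctmx M.
Proof.
apply/matrixP => i j; rewrite !mxE raddf_sum; apply: eq_bigr => l _.
by rewrite !mxE; exact: qconjM.
Qed.

Lemma is_mxderive_ctmx p m (x : R -> 'M[quat R]_(p, m)) t dx :
  is_mxderive x t dx -> is_mxderive (fun s => ctmx (x s)) t (ctmx dx).
Proof.
move=> dxP i j; under eq_fun do rewrite !mxE.
by rewrite !mxE; exact: is_qderive_conj.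
Qed.

Lemma row_solution_ctmx n I (A : R -> 'M[quat R]_n) b x :
  row_solution I A b x ->
  col_solution I (fun t => ctmx (A t)) (fun t => ctmx (b t))
    (fun t => ctmx (x t)).
Proof. by move=> xP t It; rewrite -ctmxM -ctmxD; exact/is_mxderive_ctmx/xP. Qed.

Lemma segment_bounded_ctmx n I (A : R -> 'M[quat R]_n) :
  segment_bounded I A -> segment_bounded I (fun t => ctmx (A t)).
Proof.
move=> bA a b Ia Ib; have [K AK] := bA _ _ Ia Ib.
by exists K => t tab i j; rewrite !mxE qnorm2_conj; exact: AK.
Qed.

(** Conjugating a right linear relation between the columns of the conjugate
    transpose gives a left linear relation, with conjugated coefficients,
    between the rows of [X]. *)
Lemma row_fundamental_ctmx n I (A X : R -> 'M[quat R]_n) :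
  row_fundamental I A X ->
  col_fundamental I (fun t => ctmx (A t)) (fun t => ctmx (X t)).
Proof.
move=> [XP Xind]; split=> [j t It|q q0 i].
  have colE s : col j (ctmx (X s)) = ctmx (row j (X s)).
    by apply/colP => i; rewrite !mxE.
  rewrite (funext colE) colE addr0 -ctmxM; apply: is_mxderive_ctmx.
  by have := XP j t It; rewrite addr0.
rewrite -[q i]qconjK (Xind (fun j => qconj (q j))) ?raddf0// => t It.
apply: (can_inj (@ctmxK _ _)); rewrite ctmx0 -[RHS](q0 t It).
apply/colP => k; rewrite !mxE !summxE raddf_sum; apply: eq_bigr => j _.
by rewrite !mxE [LHS]qconjM qconjK.
Qed.

End ConjugateTranspose.

Theorem theorem3p6 (R : realType) (n : nat) (I : set R)
    (openI : open I) (intervalI : is_interval I)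
    (A : R -> 'M[quat R]_n) (contA : {within I, continuous A}) :
  (forall (b : R -> 'cV[quat R]_n) (Xr : R -> 'M[quat R]_n)
          (u x : R -> 'cV[quat R]_n),
     {within I, continuous b} ->
     col_fundamental I A Xr ->
     col_solution I A b u ->
     col_solution I A b x ->
     exists q : 'cV[quat R]_n, forall t, I t -> x t = Xr t *m q + u t) /\
  (forall (b : R -> 'rV[quat R]_n) (Xl : R -> 'M[quat R]_n)
          (u x : R -> 'rV[quat R]_n),
     {within I, continuous b} ->
     row_fundamental I A Xl ->
     row_solution I A b u ->
     row_solution I A b x ->
     exists q : 'rV[quat R]_n, forall t, I t -> x t = q *m Xl t + u t).
Proof.
have bA := continuous_segment_bounded intervalI contA.
split=> b X u x _ Xfund uP xP.
  have [q qP] := col_fundamental_span intervalI bA Xfund (col_solutionB xP uP).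
  by exists q => t It; rewrite -(qP t It) subrK.
have [q qP] := col_fundamental_span intervalI (segment_bounded_ctmx bA)
  (row_fundamental_ctmx Xfund)
  (col_solutionB (row_solution_ctmx xP) (row_solution_ctmx uP)).
exists (ctmx q) => t It; apply: (can_inj (@ctmxK _ _ _)).
by rewrite ctmxD ctmxM ctmxK -(qP t It) subrK.
Qed.
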